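(* Let $p=(p_i)_{i\in\mathbb{N}}$ be a probability distribution over $\mathbb{N}$, let $\hat p$ be its MLE based on $n$ independent observations, and put $v^*=v^*(p)$, $V^*=V^*(p)$. For $n\ge 81$ and $\delta\in(0,1)$, the following holds with probability at least $1-\delta-81/n$: $$\|p-\hat p\|_\infty\le 2\sqrt{\frac{V^*}{n}+\frac{v^*}{n}\log\frac2\delta}+\frac{4}{3n}\log\frac{2(n+1)}{\delta}+\frac{\log n}{n}\le 2\sqrt{\frac{\varphi(v^* )}{n}+\frac{v^*}{n}\log\frac2\delta}+\frac{4}{3n}\log\frac{2(n+1)}{\delta}+\frac{\log n}{n};$$ and $$\|p-\hat p\|_\infty\le 2\sqrt{\frac{v^*\log(n+1)}{n}+\frac{v^*}{n}\log\frac2\delta}+\frac{4}{3n}\log\frac{2(n+1)}{\delta}+\frac{\log n}{n}.$$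
   Context: $\mathbb{N}=\{1,2,\dots\}$; the support of $p$ may be finite or infinite. For i.i.d. draws $X^n=(X_1,\dots,X_n)$ from $p$, $\hat p_i=c_i(X^n)/n$ where $c_i(X^n)$ is the number of appearances of symbol $i$. $\|p-\hat p\|_\infty=\sup_{i\in\mathbb{N}}|p_i-\hat p_i|$. Define $v_i(p)=p_i(1-p_i)$, $v^*(p)=\max_{i\in\mathbb{N}}v_i(p)$, and $V^*(p)=\sup_{i\in\mathbb{N}}v_i(p^\downarrow)\log(i+1)$, where $p^\downarrow$ is $p$ sorted in non-increasing order. $\varphi(t)=t\log\frac1t$ for $0\le t\le1$ (with $\varphi(0)=0$). $\log$ is the natural logarithm. *)

(* Defs.v *)
From HB Require Import structures.
From mathcomp Require Import all_boot all_order all_algebra.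
From mathcomp Require Import all_classical all_reals all_analysis.
Set Implicit Arguments.
Unset Strict Implicit.
Unset Printing Implicit Defensive.
Import Order.TTheory GRing.Theory Num.Theory.
Import numFieldNormedType.Exports.
Local Open Scope classical_set_scope.
Local Open Scope ring_scope.

(* The alphabet {1, 2, ...} is encoded by nat, index i standing for the symbol
   i.+1.  The encoding is visible only in the factor log (i + 1) of Vstar, which
   becomes ln i.+2. *)

Definition is_distr (R : realType) (p : nat -> R) : Prop :=
  (forall i, 0 <= p i) /\ series p @ \oo --> (1 : R).

Definition independent_family (R : realType) (d : measure_display)
    (T : measurableType d) (P : probability T R) (n : nat)
    (X : 'I_n -> {RV P >-> nat}) : Prop :=
  forall (J : {set 'I_n}) (A : 'I_n -> set nat),
    (forall j, measurable (A j)) ->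
    P (\bigcap_(j in [set` J]) X j @^-1` A j) =
    (\prod_(j in J) P (X j @^-1` A j))%E.

Definition iid_sample (R : realType) (d : measure_display)
    (T : measurableType d) (P : probability T R) (p : nat -> R) (n : nat)
    (X : 'I_n -> {RV P >-> nat}) : Prop :=
  independent_family X /\
  forall (j : 'I_n) (i : nat), P (X j @^-1` [set i]) = (p i)%:E.

Definition occurrences (n : nat) (x : 'I_n -> nat) (i : nat) : nat :=
  #|[pred j : 'I_n | x j == i]|.

Definition mle (R : realType) (n : nat) (x : 'I_n -> nat) (i : nat) : R :=
  (occurrences x i)%:R / n%:R.

(* The three suprema below are suprema in R; for a distribution p (and an
   empirical distribution q) the families are bounded, by 1, 1 / 4 and 1.  The
   one defining vstar is a maximum, since var_at p tends to 0. *)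

Definition linf_dist (R : realType) (p q : nat -> R) : R :=
  sup (range (fun i => `|p i - q i|)).

Definition var_at (R : realType) (p : nat -> R) (i : nat) : R :=
  p i * (1 - p i).

Definition vstar (R : realType) (p : nat -> R) : R := sup (range (var_at p)).

Definition maximizers (R : realType) (p : nat -> R) (s : seq nat) : set nat :=
  [set i | i \notin s /\ forall j, j \notin s -> p j <= p i].

(* Sorting by repeated selection: the indices of the k largest entries of p,
   ties being broken arbitrarily (this does not affect desc).  If p has infinite
   support, the zero entries are never selected. *)
Fixpoint selected (R : realType) (p : nat -> R) (k : nat) : seq nat :=
  if k is k'.+1 then
    rcons (selected p k') (xget 0%N (maximizers p (selected p k')))
  else [::].

Definition ranking (R : realType) (p : nat -> R) (k : nat) : nat :=
  xget 0%N (maximizers p (selected p k)).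

Definition desc (R : realType) (p : nat -> R) (k : nat) : R := p (ranking p k).

Definition Vstar (R : realType) (p : nat -> R) : R :=
  sup (range (fun i : nat => var_at (desc p) i * ln (i.+2%:R : R))).

(* At t = 0 this is 0 * ln 0^-1 = 0. *)
Definition phi (R : realType) (t : R) : R := t * ln t^-1.

Section Sorting.
Variables (R : realType) (p : nat -> R).
Hypothesis p_distr : is_distr p.

Let small e : 0 < e -> exists N, forall j, (N <= j)%N -> p j < e.
Proof.
case: p_distr => p0 ps e0.
have /cvgrPdist_lt /(_ e e0) [N _ HN] : p @ \oo --> (0 : R).
  by apply: cvg_series_cvg_0; apply/cvg_ex; exists 1.
exists N => j /HN /=; rewrite sub0r normrN ger0_norm //.
Qed.

Lemma maximizers_nonempty (s : seq nat) : maximizers p s !=set0.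
Proof.
have [p0 _] := p_distr.
have [[i0 i0s pi0]|H] := pselect (exists2 i, i \notin s & 0 < p i); last first.
  have fr : (\max_(i <- s) i).+1 \notin s.
    apply/negP => /(@leq_bigmax_seq _ s xpredT (fun i => i)) /(_ erefl).
    by rewrite ltnn.
  exists (\max_(i <- s) i).+1; split=> // j js.
  apply: le_trans (p0 _); rewrite leNgt; apply/negP => pj.
  by apply: H; exists j.
have [N HN] := small pi0.
have lei0 : (i0 < (maxn N i0).+1)%N by rewrite ltnS leq_maxr.
case: (@Order.TotalTheory.arg_maxP _ _ 'I_(maxn N i0).+1 (Ordinal lei0)
  (fun i => val i \notin s) (fun i => p i) i0s) => i i_s imax.
exists i; split=> // j js.
have [jN|jN] := leqP j (maxn N i0).
  exact: (imax (Ordinal (jN : (j < (maxn N i0).+1)%N))).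
apply: le_trans (imax (Ordinal lei0) i0s); apply/ltW/HN.
by apply: leq_trans (ltnW jN); rewrite leq_maxl.
Qed.

Lemma rankingP k : maximizers p (selected p k) (ranking p k).
Proof. exact: xgetPex (maximizers_nonempty _). Qed.

Lemma mem_selected i k :
  reflect (exists2 j, (j < k)%N & i = ranking p j) (i \in selected p k).
Proof.
apply: (iffP idP) => [|[j jk ->]].
  elim: k => //= k IH; rewrite mem_rcons in_cons => /orP[/eqP ->|/IH[j jk ->]].
    by exists k.
  by exists j => //; exact: ltnW.
elim: k jk => //= k IH; rewrite ltnS leq_eqVlt mem_rcons in_cons.
by case/orP => [/eqP ->|/IH ->]; rewrite ?eqxx ?orbT.
Qed.

Lemma ranking_inj : injective (ranking p).
Proof.
suff H j k : (j < k)%N -> ranking p j != ranking p k.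
  move=> j k e; case: (ltngtP j k) => // /H; by rewrite e eqxx.
move=> jk; have [+ _] := rankingP k; apply: contra => /eqP <-.
by apply/mem_selected; exists j.
Qed.

Lemma desc_nonincreasing j k : (j <= k)%N -> desc p k <= desc p j.
Proof.
move=> jk; have [_ +] := rankingP j; apply.
have [+ _] := rankingP k; apply: contra => /mem_selected[l lj ->].
by apply/mem_selected; exists l => //; exact: leq_trans jk.
Qed.

Lemma ranking_support i : 0 < p i -> exists k, ranking p k = i.
Proof.
move=> pi0; apply: contrapT => H.
have big k : p i <= p (ranking p k).
  have [_ +] := rankingP k; apply.
  by apply/negP => /mem_selected[j _ e]; apply: H; exists j.
have [N HN] := small pi0.
have lt k : (ranking p k < N)%N.
  by rewrite ltnNge; apply/negP => /HN; rewrite ltNge big.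
have inj : injective (fun k : 'I_N.+1 => Ordinal (lt k)).
  by move=> a b /(congr1 val) /= /ranking_inj /val_inj.
by have := leq_card _ inj; rewrite !card_ord ltnn.
Qed.

End Sorting.

(* Main.v *)
Require Import Defs.
From HB Require Import structures.
From mathcomp Require Import all_boot all_order all_algebra.
From mathcomp Require Import all_classical all_reals all_analysis.
From mathcomp Require Import ring lra.
Set Implicit Arguments.
Unset Strict Implicit.
Unset Printing Implicit Defensive.
Import Order.TTheory GRing.Theory Num.Theory.
Import numFieldNormedType.Exports.
Local Open Scope classical_set_scope.
Local Open Scope ring_scope.

(** The deviations are controlled symbol by symbol, and the confidence delta is
    spent along the ranks of the sorted distribution rather than uniformly.

    The symbol of rank k (counted from 0) gets the share
    delta_k = delta / ((k+1)(k+2)).  These shares telescope to at most delta,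
    while log (2 / delta_k) <= 2 log (k+2) + log (2 / delta).  In Bernstein's
    inequality the variance v of that symbol multiplies this logarithm, so that
    v log (k+2), the k-th term of Vstar, appears under the square root; bounding
    v by vstar and k+2 by n+1 instead gives the second inequality on the same
    event.  Only the n first ranks are treated in this way
    (prob_large_deviation), so the linear term of Bernstein's inequality is at
    most 4 / (3 n) log (2 (n+1) / delta).

    Every other symbol has probability at most 1 / n, because the n-th largest
    entry of a distribution is at most 1 / n (ranking_small).  Such a symbol
    violates the bound only if it occurs more than 2 log n times, since the
    right-hand side is at least 2 log n / n.  K occurrences have probability at
    most (n p_i)^K / K! <= n p_i / K!, and summing over i leaves n / K!, which
    is at most 81 / n for K > 2 log n (prob_overcrowding).

    No integral is needed for Bernstein's inequality: independence gives the
    exact probability of each subset of positions occupied by a symbol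
    (occ_pattern), and expanding the n-th power of the moment generating
    function of a Bernoulli variable over these subsets gives Chernoff's bound
    (occ_chernoff).  The moment generating function is bounded through a Pade
    approximant of the exponential (expR_pade).

    Finally Vstar <= phi vstar (Vstar_le_phi): the entry of rank k being at
    most 1 / (k+1), its variance is at most 1 / (k+2), which bounds the k-th
    term of Vstar by the value of phi at this variance, and phi is monotone on
    [0, 1/4], where all variances lie. *)

(** * The exponential, the logarithm and phi *)

Section Analysis.
Variable R : realType.
Implicit Types x y p l : R.

Lemma derive_ge0_le (f df : R -> R) :
    (forall x, is_derive x 1 f (df x)) -> (forall x, 0 <= df x) ->
  {homo f : x y / x <= y}.
Proof.
move=> fdf df0 x y xy.
have cf : {within `[x, y], continuous f}.
  apply: continuous_subspaceT => z; apply: differentiable_continuous.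
  by apply/derivable1_diffP; have [] := fdf z.
have [c _ E] := MVT_segment xy (fun z _ => fdf z) cf.
by rewrite -subr_ge0 E mulr_ge0 // subr_ge0.
Qed.

(** The difference of the two sides vanishes to first order at 0 and is convex:
    its second derivative 2 (1 - (1 - x) exp x) is nonnegative because
    1 - x <= exp (- x).  For x < 3 this bounds exp x by its (2, 1) Pade
    approximant. *)
Lemma expR_pade x : (6 - 2 * x) * expR x <= 6 + 4 * x + x ^+ 2.
Proof.
pose f y : R := 6 + 4 * y + y ^+ 2 - (6 - 2 * y) * expR y.
pose f1 y : R := 4 + 2 * y - (4 - 2 * y) * expR y.
pose f2 y : R := 2 - (2 - 2 * y) * expR y.
have df y : is_derive y 1 f (f1 y).
  apply: is_derive_eq; rewrite /f1 /GRing.scale/=; ring.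
have df1 y : is_derive y 1 f1 (f2 y).
  apply: is_derive_eq; rewrite /f2 /GRing.scale/=; ring.
have f2_ge0 y : 0 <= f2 y.
  have : (1 - y) * expR y <= 1.
    by rewrite -ler_pdivlMr ?expR_gt0// div1r -expRN -[_ - _]/(1 + - y) expR_ge1Dx.
  rewrite /f2; lra.
have f1_mono := derive_ge0_le df1 f2_ge0.
have f10 : f1 0 = 0 by rewrite /f1 expR0; ring.
have f0 : f 0 = 0 by rewrite /f expR0; ring.
have cf a b : {within `[a, b], continuous f}.
  apply: continuous_subspaceT => z; apply: differentiable_continuous.
  by apply/derivable1_diffP; have [] := df z.
rewrite -subr_ge0 -/(f x); have [x0|/ltW x0] := leP 0 x.
  have [c] := MVT_segment x0 (fun z _ => df z) (cf _ _).
  rewrite in_itv/= => /andP[c0 _]; rewrite f0 !subr0 => ->.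
  by rewrite mulr_ge0 // -f10 f1_mono.
have [c] := MVT_segment x0 (fun z _ => df z) (cf _ _).
rewrite in_itv/= => /andP[_ c0]; rewrite f0 !sub0r => /eqP; rewrite eqr_oppLR => /eqP ->.
by rewrite -mulrN opprK mulr_le0 // -f10 f1_mono.
Qed.

(** The Pade approximant of expR_pade equals 1 + x + x^2 / (2 (1 - x / 3)); the
    fixed l in the denominator makes the bound quadratic in x. *)
Lemma expR_bernstein x l : x <= l -> l < 3 ->
  expR x <= 1 + x + x ^+ 2 / (2 * (1 - l / 3)).
Proof.
move=> xl l3; have x3 : 0 < 6 - 2 * x by lra.
have -> : 2 * (1 - l / 3) = (6 - 2 * l) / 3 by field.
have : expR x <= 1 + x + x ^+ 2 * 3 / (6 - 2 * x).
  have -> : 1 + x + x ^+ 2 * 3 / (6 - 2 * x) = (6 + 4 * x + x ^+ 2) / (6 - 2 * x).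
    by field; rewrite gt_eqF.
  by rewrite ler_pdivlMr // mulrC expR_pade.
move/le_trans; apply; rewrite lerD2l invf_div mulrA ler_wpM2l //.
  by rewrite mulr_ge0 ?sqr_ge0.
by rewrite lef_pV2 ?posrE; lra.
Qed.

(** A centred Bernoulli variable takes the values 1 - p and - p, both at most
    1, so expR_bernstein applies to l times it; the linear terms cancel in the
    mean. *)
Lemma bernoulli_mgf p l : 0 <= p <= 1 -> 0 <= l < 3 ->
  p * expR (l * (1 - p)) + (1 - p) * expR (- (l * p)) <=
  expR (p * (1 - p) * (l ^+ 2 / (2 * (1 - l / 3)))).
Proof.
move=> /andP[p0 p1] /andP[l0 l3]; set c := 2 * _.
have H1 : expR (l * (1 - p)) <= 1 + l * (1 - p) + (l * (1 - p)) ^+ 2 / c.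
  by apply: expR_bernstein => //; nra.
have H2 : expR (- (l * p)) <= 1 - l * p + (- (l * p)) ^+ 2 / c.
  by apply: expR_bernstein => //; nra.
apply: le_trans (expR_ge1Dx _).
have q0 : 0 <= 1 - p by lra.
have := lerD (ler_wpM2l p0 H1) (ler_wpM2l q0 H2).
move=> /le_trans; apply; rewrite le_eqVlt; apply/orP; left; apply/eqP; ring.
Qed.

Lemma expR1_le4 : expR 1 <= 4 :> R.
Proof.
have H : expR (1/2) <= 2 :> R.
  rewrite -[leRHS]invrK -[expR _]invrK -expRN lef_pV2 ?posrE ?expR_gt0 //.
  by apply: le_trans (expR_ge1Dx _); lra.
have -> : 1 = 1/2 + 1/2 :> R by field.
rewrite expRD; have := expR_gt0 (1/2 : R); nra.
Qed.

(** phi increases on [0, 1/e].  Since ln (y / x) <= y / x - 1, one has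
    phi x <= x ln (1/y) + (y - x), and y - x <= (y - x) ln (1/y) because
    e <= 4 <= 1/y. *)
Lemma phi_le_quarter x y : 0 <= x -> x <= y -> y <= 4^-1 -> phi x <= phi y.
Proof.
rewrite le_eqVlt => /predU1P[<- y0 y4|x0 xy y4].
  rewrite {1}/phi mul0r /phi; move: y0; rewrite le_eqVlt => /predU1P[<-|y0].
    by rewrite mul0r.
  rewrite mulr_ge0 ?(ltW y0)// ln_ge0 // invf_ge1 //; lra.
have y0 : 0 < y := lt_le_trans x0 xy.
have ly : 1 <= ln y^-1.
  rewrite -(expRK 1) ler_ln ?posrE ?expR_gt0 ?invr_gt0//.
  apply: le_trans expR1_le4 _.
  by rewrite -[4]invrK lef_pV2 ?posrE ?invr_gt0.
have lxy : ln x^-1 <= ln y^-1 + (y / x - 1).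
  have {1}-> : x^-1 = y^-1 * (y / x) by field; rewrite !gt_eqF.
  rewrite lnM ?posrE ?invr_gt0 ?divr_gt0// lerD2l.
  have /le_ln1Dx : -1 < y / x - 1 by have := divr_gt0 y0 x0; lra.
  by rewrite (_ : 1 + (y / x - 1) = y / x); last by ring.
rewrite /phi; have := ler_wpM2l (ltW x0) lxy.
have -> : x * (ln y^-1 + (y / x - 1)) = x * ln y^-1 + (y - x).
  by field; rewrite gt_eqF.
move/le_trans; apply; nra.
Qed.

Lemma var_at_le4 (p : nat -> R) i : var_at p i <= 4^-1.
Proof. by rewrite /var_at; have := sqr_ge0 (p i - 2^-1); nra. Qed.

End Analysis.

(** * Sorted probabilities and the inequality between Vstar and phi *)

Section Ranks.
Variables (R : realType) (p : nat -> R).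
Hypothesis hp : is_distr p.

Let p_ge0 i : 0 <= p i. Proof. by have [+ _] := hp; apply. Qed.

Lemma distr_sum_le1 (s : seq nat) : uniq s -> \sum_(i <- s) p i <= 1.
Proof.
move=> us; pose N := (\max_(i <- s) i).+1.
have sN i : i \in s -> (i < N)%N.
  by move=> /(@leq_bigmax_seq _ s xpredT (fun i => i)) /(_ erefl).
have ps : perm_eq s [seq i <- index_iota 0 N | i \in s].
  apply: uniq_perm => // [|i]; first exact/filter_uniq/iota_uniq.
  by rewrite mem_filter mem_index_iota; case: (boolP (i \in s)) => // /sN ->.
rewrite (perm_big _ ps) big_filter big_mkcond; apply: (@le_trans _ _ (series p N)).
  by rewrite /series/=; apply: ler_sum => i _; case: ifP.
have [_ p1] := hp; rewrite -(cvg_lim _ p1) //; apply: nondecreasing_cvgn_le.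
  by apply: nondecreasing_series.
by apply/cvg_ex; exists 1.
Qed.

Lemma distr_le1 i : p i <= 1.
Proof. by have := @distr_sum_le1 [:: i] erefl; rewrite big_seq1. Qed.

Lemma desc_le_invS k : desc p k <= k.+1%:R^-1.
Proof.
have /distr_sum_le1 : uniq [seq ranking p j | j <- iota 0 k.+1].
  by rewrite map_inj_uniq ?iota_uniq//; exact: ranking_inj.
rewrite big_map => H; rewrite -[leRHS]mul1r ler_pdivlMr ?ltr0n//.
apply: le_trans H; have -> : desc p k * k.+1%:R = \sum_(j <- iota 0 k.+1) desc p k.
  by rewrite big_const_seq count_predT size_iota iter_addr_0 mulr_natr.
rewrite big_seq [leRHS]big_seq; apply: ler_sum => j; rewrite mem_iota => /andP[_ jk].
exact: desc_nonincreasing.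
Qed.

(** This separates the symbols treated by Bernstein's inequality from those
    whose mean number of occurrences is at most 1. *)
Lemma ranking_small n i : (0 < n)%N ->
  (exists2 k, (k < n)%N & ranking p k = i) \/ p i <= n%:R^-1.
Proof.
move=> n0; have [[k kn <-]|H] := pselect (exists2 k, (k < n)%N & ranking p k = i).
  by left; exists k.
right; rewrite -{1}(prednK n0); apply: le_trans (desc_le_invS n.-1).
have [_] := rankingP hp n.-1; apply; apply/negP => /mem_selected[j jn e].
by apply: H; exists j => //; apply: leq_trans jn (leq_pred _).
Qed.

Lemma var_at_ge0 i : 0 <= var_at p i.
Proof. by rewrite /var_at mulr_ge0 // subr_ge0 distr_le1. Qed.

Lemma var_at_desc k : var_at (desc p) k = var_at p (ranking p k).
Proof. by []. Qed.

Lemma var_at_vstar i : var_at p i <= vstar p.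
Proof.
apply: ub_le_sup; last by exists i.
by exists 4^-1 => _ [j _ <-]; exact: var_at_le4.
Qed.

Lemma vstar_ge0 : 0 <= vstar p.
Proof. exact: le_trans (var_at_ge0 0) (var_at_vstar 0). Qed.

Lemma vstar_le4 : vstar p <= 4^-1.
Proof.
by apply: ge_sup; [exists (var_at p 0), 0%N | move=> _ [j _ <-]; exact: var_at_le4].
Qed.

(** With x <= 1 / (k+1) one gets x (1 - x) (k + 2) <= (1 - x) (1 + x) <= 1. *)
Lemma var_at_desc_le k : var_at (desc p) k <= k.+2%:R^-1.
Proof.
rewrite -[leRHS]mul1r ler_pdivlMr ?ltr0n// /var_at.
have := desc_le_invS k; rewrite -[leRHS]mul1r ler_pdivlMr ?ltr0n//.
have x0 : 0 <= desc p k := p_ge0 _.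
have x1 : desc p k <= 1 := distr_le1 _.
by rewrite -[k.+2]addn1 natrD; move: (k.+1%:R : R) => m; nra.
Qed.

(** The bound of var_at_desc_le turns ln (k+2) into ln (1/v), that is, the
    term into phi v.  It also shows that the supremum defining Vstar is
    finite. *)
Lemma Vstar_term_le_phi k :
  var_at (desc p) k * ln (k.+2%:R : R) <= phi (vstar p).
Proof.
have v0 : 0 <= var_at (desc p) k by rewrite var_at_desc var_at_ge0.
have vv : var_at (desc p) k <= vstar p by rewrite var_at_desc var_at_vstar.
apply: le_trans (phi_le_quarter v0 vv vstar_le4).
move: v0; rewrite /phi le_eqVlt => /predU1P[<-|v0]; first by rewrite !mul0r.
rewrite ler_wpM2l ?(ltW v0)// ler_ln ?posrE ?invr_gt0 ?ltr0n//.
by rewrite -[leLHS]invrK lef_pV2 ?posrE ?invr_gt0 ?ltr0n// var_at_desc_le.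
Qed.

Lemma Vstar_le_phi : Vstar p <= phi (vstar p).
Proof.
apply: ge_sup; last by move=> _ [k _ <-]; exact: Vstar_term_le_phi.
by exists (var_at (desc p) 0 * ln 2%:R), 0%N.
Qed.

Lemma Vstar_ub k : var_at (desc p) k * ln (k.+2%:R : R) <= Vstar p.
Proof.
apply: ub_le_sup; last by exists k.
by exists (phi (vstar p)) => _ [j _ <-]; exact: Vstar_term_le_phi.
Qed.

End Ranks.

(** * The law of the number of occurrences of a symbol *)

Section FiniteProbability.
Variables (R : realType) (d : measure_display) (T : measurableType d).
Variables (P : probability T R).

(** A sample takes countably many values, so every event about it is a
    countable union of measurable ones. *)
Lemma measurable_sample_event n (X : 'I_n -> {RV P >-> nat})
  (Q : ('I_n -> nat) -> Prop) : measurable [set t | Q (fun j => X j t)].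
Proof.
have mX j A : measurable (X j @^-1` A).
  by rewrite -[X in measurable X]setTI; exact: measurable_funP.
pose F (f : {ffun 'I_n -> nat}) :=
  if pselect (Q f) then \bigcap_(j in [set: 'I_n]) (X j @^-1` [set f j]) else set0.
have -> : [set t | Q (fun j => X j t)] = \bigcup_f F f.
  apply/seteqP; split=> [t /= Qt|t [f _]].
    exists [ffun j => X j t] => //; rewrite /F; case: pselect => [_ j _|] /=.
      by rewrite ffunE.
    case; suff -> : [ffun j => X j t] = (fun j => X j t) :> ('I_n -> nat) by [].
    by apply: funext => j; rewrite ffunE.
  rewrite /F; case: pselect => // Qf H.
  rewrite /=; suff -> : (fun j => X j t) = f :> ('I_n -> nat) by [].
  by apply: funext => j; exact: H.
apply: countable_bigcupT_measurable => [|f]; first exact: countableP.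
rewrite /F; case: pselect => /= [Qf|//]; apply: fin_bigcap_measurable => //.
Qed.

Lemma measure_finite_union (I : finType) (Q : pred I) (F : I -> set T) (A : set T) :
    measurable A -> (forall i, measurable (F i)) ->
    (forall t, A t -> exists2 i, Q i & F i t) ->
  (P A <= \sum_(i | Q i) P (F i))%E.
Proof.
move=> mA mF AF; pose U := \big[setU/set0]_(i | Q i) F i.
have mU : measurable U by exact: bigsetU_measurable.
apply: (@le_trans _ _ (P U)).
  rewrite le_measure ?inE // => t /AF[i Qi Fit].
  by rewrite /U (bigD1 i) //=; left.
suff [] : measurable U /\ (P U <= \sum_(i | Q i) P (F i))%E by [].
rewrite /U; apply: (big_ind2 (fun S s => measurable S /\ (P S <= s)%E)).
- by rewrite measure0.
- move=> S1 s1 S2 s2 [m1 l1] [m2 l2]; split; first exact: measurableU.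
  exact: le_trans (measureU2 _ _ _) (leeD _ _).
- by move=> i Qi.
Qed.

End FiniteProbability.

Section Counts.
Variables (R : realType) (p : nat -> R).
Variables (d : measure_display) (T : measurableType d) (P : probability T R).
Variables (n : nat) (X : 'I_n -> {RV P >-> nat}).
Hypothesis hX : iid_sample p X.
Variable i : nat.
Hypothesis p01 : 0 <= p i <= 1.

Let occ t := occurrences (fun j => X j t) i.

(** Independence applied to the preimages of {i} for the positions in J and of
    its complement for the others. *)
Lemma occ_pattern (J : {set 'I_n}) :
  P [set t | forall j, (X j t == i) = (j \in J)] =
  (\prod_(j : 'I_n) (if j \in J then p i else 1 - p i))%:E.
Proof.
have [ind marg] := hX.
pose A (j : 'I_n) : set nat := if j \in J then [set i] else ~` [set i].
have -> : [set t | forall j, (X j t == i) = (j \in J)] =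
    \bigcap_(j in [set` [set: 'I_n]%SET]) X j @^-1` A j.
  apply/seteqP; split=> t /= H j.
    by move=> _; rewrite /A; have := H j; case: ifP => _ /= /eqP.
  have := H j; rewrite /A /= inE => /(_ erefl).
  by case: ifP => _ /= /eqP // /negbTE.
rewrite ind //.
rewrite -prodEFin; apply: eq_big => [j|j _]; first by rewrite inE.
rewrite /A; case: ifP => _; first exact: marg.
rewrite -preimage_setC probability_setC ?marg //.
by rewrite -[X in measurable X]setTI; exact: measurable_funP.
Qed.

(** Markov's inequality for the exponential of the centred count, written as a
    sum over the sets of positions at which the symbol occurs.  The parameter l
    may have either sign, so both tails are covered. *)
Lemma occ_chernoff (l a : R) :
  (P [set t | (a <= l * ((occ t)%:R - n%:R * p i))%R] <=
   (expR (- a) *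
    (p i * expR (l * (1 - p i)) + (1 - p i) * expR (- (l * p i))) ^+ n)%:E)%E.
Proof.
pose W (J : {set 'I_n}) : R := \prod_(j : 'I_n) (if j \in J then p i else 1 - p i).
pose g k : R := l * (k%:R - n%:R * p i).
have mE (J : {set 'I_n}) : measurable [set t | forall j, (X j t == i) = (j \in J)].
  exact: (measurable_sample_event X (fun x => forall j, (x j == i) = (j \in J))).
have /andP[p0 p1] := p01.
have W0 J : 0 <= W J by apply: prodr_ge0 => j _; case: ifP; lra.
have H := @measure_finite_union _ _ _ P _ (fun J : {set 'I_n} => a <= g #|J|) _
  [set t | a <= l * ((occ t)%:R - n%:R * p i)] _ mE.
apply: le_trans (H _ _) _ => {H}.
- exact: (measurable_sample_event X (fun x => a <= g (occurrences x i))).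
- move=> t /= H; exists [set j | X j t == i]%SET.
    by rewrite cardsE.
  by move=> j /=; rewrite inE.
under eq_bigr do rewrite occ_pattern.
rewrite sumEFin lee_fin.
apply: (@le_trans _ _ (\sum_(J : {set 'I_n}) W J * expR (g #|J| - a))).
  rewrite big_mkcond; apply: ler_sum => J _; case: ifP => [H|_].
    by rewrite -/(W J) ler_peMr // -expR0 ler_expR subr_ge0.
  by rewrite mulr_ge0 ?expR_ge0.
rewrite le_eqVlt; apply/orP; left; apply/eqP.
have -> : (p i * expR (l * (1 - p i)) + (1 - p i) * expR (- (l * p i))) ^+ n =
  \prod_(j : 'I_n) (p i * expR (l * (1 - p i)) + (1 - p i) * expR (- (l * p i))).
  by rewrite prodr_const card_ord.
(* The n-th power is the sum over J of the product of the weights of J. *)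
rewrite bigA_distr mulr_sumr; apply: eq_bigr => J _.
have -> : expR (g #|J| - a) = expR (- a) * \prod_(j : 'I_n) expR (l * ((j \in J)%:R - p i)).
  rewrite -expR_sum -expRD addrC; congr (expR (_ + _)).
  rewrite -mulr_sumr sumrB sumr_const card_ord /g mulr_natl; congr (_ * (_ - _)).
    by rewrite -natr_sum -sum1_card big_mkcond /=; congr (_%:R);
      apply: eq_bigr => j _; case: ifP.
rewrite mulrCA -big_split; congr (_ * _); apply: eq_bigr => j _ /=.
by case: ifP => _; congr (_ * expR _); rewrite /=; ring.
Qed.

End Counts.

(** * Tail bounds for the number of occurrences *)

Section Tails.
Variables (R : realType) (p : nat -> R).
Variables (d : measure_display) (T : measurableType d) (P : probability T R).
Variables (n : nat) (X : 'I_n -> {RV P >-> nat}).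
Hypothesis hX : iid_sample p X.
Variable i : nat.
Hypothesis p01 : 0 <= p i <= 1.

Let occ t := occurrences (fun j => X j t) i.

(** The Chernoff exponent at s = w r + r^2 / 3, where w^2 is the variance of the
    count.  The denominator w + r / 3 would suit the sharper deviation
    w r + r^2 / 6; the larger one used here keeps l < 3 even if w = 0, so that
    the degenerate cases p i = 0 and p i = 1 need no separate treatment. *)
Lemma bernstein_exponent (w r : R) : 0 <= w -> 0 < r ->
  forall l, l = r / (w + 2 / 3 * r) ->
  w ^+ 2 * (l ^+ 2 / (2 * (1 - l / 3))) - l * (w * r + r ^+ 2 / 3) <= - (r ^+ 2 / 2).
Proof.
move=> w0 r0 l lE.
have D0 : 0 < w + 2 / 3 * r by lra.
have E0 : 0 < w + r / 3 by lra.
have -> : 1 - l / 3 = (w + r / 3) / (w + 2 / 3 * r).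
  by rewrite lE; field; rewrite gt_eqF //; lra.
rewrite -subr_ge0.
have -> : - (r ^+ 2 / 2) - (w ^+ 2 * (l ^+ 2 / (2 * ((w + r / 3) / (w + 2 / 3 * r)))) -
    l * (w * r + r ^+ 2 / 3)) =
    (w * r ^+ 3 / 6) / ((w + r / 3) * (w + 2 / 3 * r)).
  rewrite lE; field; rewrite !gt_eqF //; lra.
by rewrite !(mulr_ge0, invr_ge0, exprn_ge0) // ltW.
Qed.

(** Both tails follow from occ_chernoff with parameters l and - l; the mgf at
    - l is that of a Bernoulli variable of mean 1 - p i at l. *)
Lemma occ_bernstein (r : R) : 0 < r ->
  (P [set t | (Num.sqrt (n%:R * var_at p i) * r + r ^+ 2 / 3 <
               `|(occ t)%:R - n%:R * p i|)%R] <= (2 * expR (- (r ^+ 2 / 2)))%:E)%E.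
Proof.
move=> r0; have /andP[p0 p1] := p01.
set w := Num.sqrt _; set s := w * r + _.
have w0 : 0 <= w := sqrtr_ge0 _.
have w2 : w ^+ 2 = n%:R * var_at p i.
  by rewrite sqr_sqrtr // !mulr_ge0 ?ler0n // subr_ge0.
pose l := r / (w + 2 / 3 * r).
have D0 : 0 < w + 2 / 3 * r by lra.
have l0 : 0 <= l by rewrite divr_ge0 // ltW.
have l3 : l < 3 by rewrite /l ltr_pdivrMr //; lra.
have l03 : 0 <= l < 3 by rewrite l0.
have key m : m <= expR (var_at p i * (l ^+ 2 / (2 * (1 - l / 3)))) -> 0 <= m ->
    expR (- (l * s)) * m ^+ n <= expR (- (r ^+ 2 / 2)).
  move=> mle m0; apply: (@le_trans _ _ (expR (- (l * s)) *
      expR (var_at p i * (l ^+ 2 / (2 * (1 - l / 3)))) ^+ n)).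
    by rewrite ler_wpM2l ?expR_ge0// lerXn2r ?nnegrE ?expR_ge0.
  rewrite -expRM_natl -expRD ler_expR mulrA -w2 addrC.
  exact: bernstein_exponent.
pose F (b : bool) := [set t | l * s <= (if b then l else - l) * ((occ t)%:R - n%:R * p i)].
have mF b : measurable (F b).
  exact: (measurable_sample_event X (fun x => l * s <= (if b then l else - l) *
           ((occurrences x i)%:R - n%:R * p i))).
have PF b : (P (F b) <= (expR (- (r ^+ 2 / 2)))%:E)%E.
  apply: (le_trans (occ_chernoff hX p01 _ _)); rewrite lee_fin; apply: key; last first.
    by rewrite addr_ge0 // mulr_ge0 ?expR_ge0// subr_ge0.
  rewrite /F; case: b; first exact: bernoulli_mgf.
  have q01 : 0 <= 1 - p i <= 1 by apply/andP; split; lra.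
  have := bernoulli_mgf q01 l03.
  by rewrite opprB addrCA subrr addr0 !mulNr opprK addrC (mulrC (1 - p i) (p i)).
have H := @measure_finite_union _ _ _ P bool xpredT F
  [set t | s < `|(occ t)%:R - n%:R * p i|] _ mF.
apply: le_trans (H _ _) _ => {H}.
- exact: (measurable_sample_event X (fun x => s < `|(occurrences x i)%:R - n%:R * p i|)).
- move=> t /= H; have [x0|/ltW x0] := leP 0 ((occ t)%:R - n%:R * p i).
    by exists true => //; rewrite /F /= ler_wpM2l // -(ger0_norm x0) ltW.
  by exists false => //; rewrite /F /= mulNr -mulrN ler_wpM2l // -(ler0_norm x0) ltW.
by rewrite big_bool mulr_natl mulr2n EFinD leeD.
Qed.

(** A union bound over the K-sets of positions gives 'C(n, K) p^K, which is at
    most (n p)^K / K!.  Keeping one factor n p makes the bound summable over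
    the symbols. *)
Lemma occ_ge (K : nat) : (0 < K)%N -> n%:R * p i <= 1 ->
  (P [set t | (K <= occ t)%N] <= ((n%:R / K`!%:R) * p i)%:E)%E.
Proof.
move=> K0 np1; have /andP[p0 p1] := p01; have [ind marg] := hX.
have mX j A : measurable (X j @^-1` A).
  by rewrite -[X in measurable X]setTI; exact: measurable_funP.
pose F (J : {set 'I_n}) := \bigcap_(j in [set` J]) X j @^-1` [set i].
have mF J : measurable (F J) by apply: fin_bigcap_measurable.
have H := @measure_finite_union _ _ _ P _ (fun J : {set 'I_n} => #|J| == K) F
  [set t | (K <= occ t)%N] _ mF.
apply: le_trans (H _ _) _ => {H}.
- exact: (measurable_sample_event X (fun x => (K <= occurrences x i)%N)).
- move=> t /= H; pose s := take K (enum [pred j | X j t == i]).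
  have us : uniq s by rewrite take_uniq // enum_uniq.
  exists [set j in s]%SET.
    by rewrite cardsE (card_uniqP us) size_takel // -cardE.
  by move=> j /=; rewrite inE => /mem_take; rewrite mem_enum => /eqP.
under eq_bigr => J /eqP JK.
  rewrite ind // (eq_bigr (fun=> (p i)%:E)); last by move=> j _; exact: marg.
  rewrite prodEFin prodr_const JK; over.
rewrite sumEFin lee_fin sumr_const.
have -> : #|[pred J : {set 'I_n} | #|J| == K]| = 'C(n, K).
  by rewrite -[n in RHS]card_ord -card_draws cardsE.
have Kf : 0 < K`!%:R :> R by rewrite ltr0n fact_gt0.
rewrite mulrAC ler_pdivlMr // -[_ ^+ K *+ _]mulr_natl mulrAC -natrM bin_ffact.
apply: (@le_trans _ _ ((n%:R * p i) ^+ K)).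
  rewrite exprMn ler_wpM2r ?exprn_ge0// -natrX ler_nat.
  rewrite ffact_prod -[K in (_ ^ K)%N]card_ord -prod_nat_const.
  by apply: leq_prod => j _; exact: leq_subr.
rewrite -(prednK K0) exprS ler_piMr ?mulr_ge0 //.
by rewrite exprn_ile1 // mulr_ge0.
Qed.

End Tails.

(** * Sharing the confidence among ranks *)

Section Thresholds.
Variable R : realType.

(** Any constant at least 4^3 / 3! would do; the value 81 is the one of the
    error term 81 / n. *)
Lemma exp4_le_fact k : (4 ^ k <= 81 * k`!)%N.
Proof.
elim: k => // k IH; rewrite expnS factS mulnCA.
have [k3|] := leqP 3 k; first exact: leq_mul.
by case: k {IH} => [|[|[|]]].
Qed.

(** n^2 = exp (2 ln n) <= e^k <= 4^k. *)
Lemma sqr_le_fact n k : (0 < n)%N -> 2 * ln (n%:R : R) <= k%:R ->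
  n%:R ^+ 2 <= 81 * k`!%:R :> R.
Proof.
move=> n0 nk; have n0R : 0 < n%:R :> R by rewrite ltr0n.
have -> : n%:R ^+ 2 = expR (2 * ln (n%:R : R)).
  by rewrite expRM_natl lnK.
apply: (@le_trans _ _ (expR 1 ^+ k)).
  by rewrite -expRM_natl mulr1 ler_expR.
apply: (@le_trans _ _ (4 ^+ k)).
  by rewrite lerXn2r ?nnegrE ?expR_ge0 ?expR1_le4.
by rewrite -natrX -natrM ler_nat exp4_le_fact.
Qed.

Lemma ln_ge1 n : (4 <= n)%N -> 1 <= ln (n%:R : R).
Proof.
move=> n4; rewrite -[leLHS]expRK ler_ln ?posrE ?expR_gt0 ?ltr0n ?(leq_trans _ n4)//.
by apply: le_trans (expR1_le4 R) _; rewrite ler_nat.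
Qed.

Lemma sum_inv_pronic n :
  \sum_(k < n) (k.+1%:R * k.+2%:R)^-1 = 1 - n.+1%:R^-1 :> R.
Proof.
elim: n => [|n IH]; first by rewrite big_ord0 invr1 subrr.
rewrite big_ord_recr /= IH -[n.+2%:R]natr1.
have : 0 < n.+1%:R :> R by rewrite ltr0n.
by move: (n.+1%:R : R) => x x0; field; rewrite !gt_eqF //; lra.
Qed.

(** This is ln (2 / delta_k) for the share delta_k = delta / ((k+1) (k+2)) of
    the confidence given to rank k: each of the two tails gets half of the
    share. *)
Definition rank_exponent (delta : R) (k : nat) : R :=
  ln (2 * (k.+1%:R * k.+2%:R) / delta).

Section RankExponent.
Variable delta : R.
Hypothesis hdelta : 0 < delta < 1.

Let delta_gt0 : 0 < delta. Proof. by case/andP: hdelta. Qed.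
Let invd : 1 < delta^-1. Proof. by rewrite invf_gt1 //; case/andP: hdelta. Qed.

Lemma rank_exponent_gt0 k : 0 < rank_exponent delta k.
Proof.
apply: ln_gt0; apply: (lt_trans invd); rewrite -[ltLHS]mul1r ltr_pM2r ?invr_gt0//.
by rewrite -!natrM ltr1n.
Qed.

Lemma expR_rank_exponent k :
  2 * expR (- rank_exponent delta k) = delta * (k.+1%:R * k.+2%:R)^-1.
Proof.
rewrite expRN lnK ?posrE ?divr_gt0 ?mulr_gt0 ?ltr0n//.
have : 0 < k.+1%:R * k.+2%:R :> R by rewrite mulr_gt0 ?ltr0n.
by move: (_ * _ : R) => x x0; field; rewrite !gt_eqF.
Qed.

Lemma rank_exponent_le_ln k :
  rank_exponent delta k <= 2 * ln (k.+2%:R : R) + ln (2 / delta).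
Proof.
have d2 : 0 < 2 / delta by rewrite divr_gt0.
rewrite mulr_natl mulr2n -!lnM ?posrE ?mulr_gt0 ?invr_gt0 ?ltr0n// /rank_exponent.
have -> : 2 * (k.+1%:R * k.+2%:R) / delta = k.+1%:R * k.+2%:R * (2 / delta) by ring.
rewrite ler_ln ?posrE ?mulr_gt0 ?invr_gt0 ?ltr0n// ler_pM2r// -!natrM ler_nat.
by rewrite leq_mul2r leqnSn orbT.
Qed.

Lemma rank_exponent_le n k : (k < n)%N ->
  rank_exponent delta k <= 2 * ln (2 * (n%:R + 1) / delta).
Proof.
move=> kn; apply: le_trans (rank_exponent_le_ln k) _.
have -> : 2 * (n%:R + 1) / delta = n.+1%:R * (2 / delta) by rewrite -natr1; ring.
rewrite [leRHS](_ : _ = 2 * (ln n.+1%:R + ln (2 / delta))); last first.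
  by rewrite lnM ?posrE ?ltr0n ?divr_gt0.
have : ln (k.+2%:R : R) <= ln (n.+1%:R : R) by rewrite ler_ln ?posrE ?ltr0n// ler_nat.
have : 0 <= ln (2 / delta) by apply: ln_ge0; have := invd; lra.
lra.
Qed.

End RankExponent.
End Thresholds.

(** * The two bad events and the bound outside them *)

(** Bernstein's radius for the count y, divided by n, in the form of the
    theorem: B is the quantity under the square root and C the logarithm of the
    linear term. *)
Lemma bernstein_radius_le (R : realType) (n : nat) (v L B C x y : R) :
    (0 < n)%N -> 0 <= v -> 0 <= L ->
    v * L <= 2 * n%:R * B -> L <= 2 * C ->
    `|y - n%:R * x| <= Num.sqrt (n%:R * v) * Num.sqrt (2 * L) + Num.sqrt (2 * L) ^+ 2 / 3 ->
  `|x - y / n%:R| <= 2 * Num.sqrt B + 4 / (3 * n%:R) * C.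
Proof.
move=> n0 v0 L0 vL LC H; have n0R : 0 < n%:R :> R by rewrite ltr0n.
have L20 : 0 <= 2 * L by rewrite mulr_ge0.
have B0 : 0 <= B by have := mulr_ge0 v0 L0; nra.
have -> : x - y / n%:R = - ((y - n%:R * x) / n%:R) by field; rewrite gt_eqF.
rewrite normrN normrM normfV (gtr0_norm n0R) ler_pdivrMr //.
apply: le_trans H _; rewrite [leRHS]mulrDl sqr_sqrtr //; apply: lerD; last first.
  have -> : 4 / (3 * n%:R) * C * n%:R = 4 / 3 * C by field; rewrite gt_eqF.
  lra.
rewrite -sqrtrM ?mulr_ge0 ?ler0n//.
have -> : 2 * Num.sqrt B * n%:R = Num.sqrt ((2 * n%:R) ^+ 2 * B).
  rewrite sqrtrM ?sqr_ge0// sqrtr_sqr ger0_norm ?mulr_ge0 ?ler0n//; ring.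
apply: ler_wsqrtr.
have -> : n%:R * v * (2 * L) = 2 * n%:R * (v * L) by ring.
have -> : (2 * n%:R) ^+ 2 * B = 2 * n%:R * (2 * n%:R * B) by ring.
by rewrite ler_wpM2l // mulr_ge0 ?ler0n.
Qed.

Section GoodSample.
Variables (R : realType) (p : nat -> R).
Hypothesis hp : is_distr p.
Variables (d : measure_display) (T : measurableType d) (P : probability T R).
Variables (n : nat) (X : 'I_n -> {RV P >-> nat}).
Hypothesis hX : iid_sample p X.
Variable delta : R.
Hypotheses (hn : (81 <= n)%N) (hdelta : 0 < delta < 1).

(** In terms of r = sqrt (2 L), the tail bound exp (- L) reads exp (- r^2 / 2),
    as in occ_bernstein. *)
Definition radius k : R := Num.sqrt (2 * rank_exponent delta k).

Definition large_deviation (x : 'I_n -> nat) : Prop :=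
  exists2 k, (k < n)%N & let i := ranking p k in
    Num.sqrt (n%:R * var_at p i) * radius k + radius k ^+ 2 / 3 <
    `|(occurrences x i)%:R - n%:R * p i|.

Definition cutoff : nat := (Num.trunc (2 * ln (n%:R : R))).+1.

Definition overcrowding (x : 'I_n -> nat) : Prop :=
  exists2 i, p i <= n%:R^-1 & (cutoff <= occurrences x i)%N.

Let p01 i : 0 <= p i <= 1.
Proof. by have [p0 _] := hp; rewrite p0 (distr_le1 hp). Qed.

Let n_gt0 : (0 < n)%N. Proof. exact: leq_trans hn. Qed.
Let nR_gt0 : 0 < n%:R :> R. Proof. by rewrite ltr0n. Qed.

Lemma prob_large_deviation :
  (P [set t | large_deviation (fun j => X j t)] <= delta%:E)%E.
Proof.
pose Q k (x : 'I_n -> nat) := let i := ranking p k in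
    Num.sqrt (n%:R * var_at p i) * radius k + radius k ^+ 2 / 3 <
    `|(occurrences x i)%:R - n%:R * p i|.
have d0 : 0 <= delta by case/andP: hdelta => /ltW.
have r0 k : 0 < radius k by rewrite sqrtr_gt0 mulr_gt0 // rank_exponent_gt0.
have H := @measure_finite_union _ _ _ P 'I_n xpredT
  (fun k : 'I_n => [set t | Q k (fun j => X j t)])
  [set t | large_deviation (fun j => X j t)].
apply: le_trans (H _ _ _) _ => {H}.
- exact: measurable_sample_event.
- by move=> k; exact: (measurable_sample_event X (Q k)).
- by move=> t [k kn Qk]; exists (Ordinal kn).
apply: (@le_trans _ _ (\sum_(k < n) (delta * (k.+1%:R * k.+2%:R)^-1)%:E)%E).
  apply: lee_sum => k _; rewrite -(expR_rank_exponent hdelta k).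
  have <- : radius k ^+ 2 / 2 = rank_exponent delta k.
    by rewrite sqr_sqrtr ?mulr_ge0 ?(ltW (rank_exponent_gt0 hdelta k))//; field.
  exact: (occ_bernstein hX (p01 (ranking p k)) (r0 k)).
by rewrite sumEFin lee_fin -mulr_sumr sum_inv_pronic ler_piMr // lerBlDr lerDl invr_ge0 ler0n.
Qed.

(** The bounds of occ_ge are proportional to p i, hence sum to n / cutoff!. *)
Lemma prob_overcrowding :
  (P [set t | overcrowding (fun j => X j t)] <= (81 / n%:R)%:E)%E.
Proof.
have [p0 _] := hp.
pose Q i (x : 'I_n -> nat) := p i <= n%:R^-1 /\ (cutoff <= occurrences x i)%N.
have mQ i : measurable [set t | Q i (fun j => X j t)].
  exact: (measurable_sample_event X (Q i)).
pose c : R := n%:R / cutoff`!%:R.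
have c0 : 0 <= c by rewrite divr_ge0 ?ler0n.
apply: (@le_trans _ _ (\sum_(0 <= i <oo) P [set t | Q i (fun j => X j t)])%E).
  apply: measure_sigma_subadditive => //.
    exact: measurable_sample_event.
  by move=> t [i pi ci]; exists i.
have PQ i : (P [set t | Q i (fun j => X j t)] <= (c * p i)%:E)%E.
  have [pi|pi] := leP (p i) n%:R^-1; last first.
    rewrite (_ : [set t | _] = set0) ?measure0 ?lee_fin ?mulr_ge0 //.
    by apply/seteqP; split=> // t [/le_lt_trans/(_ pi)]; rewrite ltxx.
  have np : n%:R * p i <= 1 by rewrite mulrC -ler_pdivlMr // div1r.
  apply: le_trans (occ_ge hX (p01 i) (ltn0Sn _) np).
  rewrite le_measure ?inE //; last by move=> t [].
  exact: (measurable_sample_event X (fun x => (cutoff <= occurrences x i)%N)).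
apply: lime_le; first exact: is_cvg_nneseries.
apply: nearW => m; apply: (@le_trans _ _ (\sum_(0 <= i < m) (c * p i)%:E)%E).
  by apply: lee_sum => i _; exact: PQ.
rewrite sumEFin lee_fin -mulr_sumr.
apply: (@le_trans _ _ c).
  by rewrite ler_piMr // (distr_sum_le1 hp) // iota_uniq.
have := @sqr_le_fact R n cutoff n_gt0 (ltW (truncnS_gt _)).
rewrite /c ler_pdivrMr ?ltr0n ?fact_gt0// mulrAC ler_pdivlMr //.
Qed.

(** The bound B under the square root is left free, because the two
    inequalities of the theorem are two choices of B on the same event.  A
    symbol beyond the n first ranks deviates by at most 2 ln n / n, which is
    covered by the two logarithmic terms alone. *)
Lemma linf_dist_mle_le (x : 'I_n -> nat) (B : R) :
    ~ large_deviation x -> ~ overcrowding x ->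
    (forall k, (k < n)%N ->
      var_at (desc p) k * rank_exponent delta k <= 2 * n%:R * B) ->
  linf_dist p (mle R x) <= 2 * Num.sqrt B
    + (4 / (3 * n%:R) * ln (2 * (n%:R + 1) / delta) + ln n%:R / n%:R).
Proof.
move=> nl no HB; set C := ln (2 * (n%:R + 1) / delta).
have lnn : 1 <= ln (n%:R : R) by apply: ln_ge1; exact: leq_trans hn.
have C_ge : ln (n%:R : R) <= C.
  have /andP[d0 d1] := hdelta.
  rewrite /C ler_ln ?posrE ?divr_gt0 ?mulr_gt0 ?addr_gt0//.
  have := ler_wpM2l (ltW nR_gt0) (ltW d1); have := nR_gt0.
  by rewrite ler_pdivlMr// mulr1; lra.
have E0 : 4 / (3 * n%:R) * C = (4 / 3 * C) / n%:R by field; rewrite gt_eqF.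
apply: ge_sup; first by exists `|p 0 - mle R x 0|, 0%N.
move=> _ [i _ <-]; have [[k kn ki]|pi] := ranking_small hp i n_gt0.
  apply: (@le_trans _ _ (2 * Num.sqrt B + 4 / (3 * n%:R) * C)); last first.
    by rewrite lerD2l lerDl divr_ge0 // ltW // (lt_le_trans ltr01).
  have L0 : 0 <= rank_exponent delta k by rewrite ltW // rank_exponent_gt0.
  apply: (@bernstein_radius_le _ n (var_at p i) (rank_exponent delta k)) => //.
  - exact: var_at_ge0.
  - by rewrite -ki -var_at_desc HB.
  - exact: rank_exponent_le.
  - rewrite leNgt; apply/negP => H; apply: nl; exists k => //=.
    by rewrite ki.
have ci : (occurrences x i)%:R <= 2 * ln (n%:R : R).
  have : (occurrences x i < cutoff)%N.
    by rewrite ltnNge; apply/negP => H; apply: no; exists i.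
  by rewrite ltnS truncn_ge_nat // mulr_ge0 // ltW // (lt_le_trans ltr01).
have [p0 _] := hp.
have s0 : 0 <= Num.sqrt B := sqrtr_ge0 _.
apply: (@le_trans _ _ (2 * ln n%:R / n%:R)); last first.
  apply: (@le_trans _ _ (4 / (3 * n%:R) * C + ln n%:R / n%:R)).
    by rewrite E0 -mulrDl ler_pM2r ?invr_gt0//; lra.
  by rewrite lerDr mulr_ge0.
have pn : p i * n%:R <= 1 by rewrite -ler_pdivlMr // div1r.
have -> : p i - mle R x i = (p i * n%:R - (occurrences x i)%:R) / n%:R.
  by rewrite /mle; field; rewrite gt_eqF.
rewrite normrM normfV (gtr0_norm nR_gt0) ler_pM2r ?invr_gt0//.
have := mulr_ge0 (p0 i) (ltW nR_gt0); have := ler0n R (occurrences x i).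
by rewrite ler_norml => ? ?; apply/andP; split; lra.
Qed.

End GoodSample.

Theorem theorem3 (R : realType) (p : nat -> R) (hp : is_distr p)
  (d : measure_display) (T : measurableType d) (P : probability T R)
  (n : nat) (X : 'I_n -> {RV P >-> nat}) (hX : iid_sample p X)
  (delta : R) (hn : (81 <= n)%N) (hdelta : 0 < delta < 1) :
  ((1 - delta - 81 / n%:R)%:E <=
   P [set t : T | (
       let dist := linf_dist p (mle R (fun j => X j t)) in
       let rest := 4 / (3 * n%:R) * ln (2 * (n%:R + 1) / delta)
                   + ln n%:R / n%:R in
       dist <= 2 * Num.sqrt (Vstar p / n%:R
                             + vstar p / n%:R * ln (2 / delta)) + rest
            <= 2 * Num.sqrt (phi (vstar p) / n%:R
                             + vstar p / n%:R * ln (2 / delta)) + rest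
       /\
       dist <= 2 * Num.sqrt (vstar p * ln (n%:R + 1) / n%:R
                             + vstar p / n%:R * ln (2 / delta)) + rest)%R])%E.
Proof.
have n0 : 0 < n%:R :> R by rewrite ltr0n (leq_trans _ hn).
have [d0 d1] := andP hdelta.
have v0 := vstar_ge0 hp.
have lnd : 0 <= ln (2 / delta).
  by apply: ln_ge0; rewrite ler_pdivlMr //; lra.
pose bad (x : 'I_n -> nat) := large_deviation p delta x \/ overcrowding p x.
set good := [set t : T | _].
have mbad : measurable [set t | bad (fun j => X j t)].
  exact: (measurable_sample_event X bad).
have Pbad : (P [set t | bad (fun j => X j t)] <= (delta + 81 / n%:R)%:E)%E.
  rewrite (_ : [set t | _] = [set t | large_deviation p delta (fun j => X j t)] `|`
                             [set t | overcrowding p (fun j => X j t)]) //.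
  rewrite EFinD; apply: le_trans (leeD (prob_large_deviation hp hX hdelta)
                                       (prob_overcrowding hp hX hn)).
  by apply: measureU2; exact: measurable_sample_event.
apply: (@le_trans _ _ (P (~` [set t | bad (fun j => X j t)]))).
  rewrite probability_setC // -addrA -opprD EFinB leeB //.
rewrite le_measure ?inE //; first exact: measurableC.
  exact: (measurable_sample_event X (fun x =>
    let dist := linf_dist p (mle R x) in
    let rest := 4 / (3 * n%:R) * ln (2 * (n%:R + 1) / delta) + ln n%:R / n%:R in
    dist <= 2 * Num.sqrt (Vstar p / n%:R + vstar p / n%:R * ln (2 / delta)) + rest
         <= 2 * Num.sqrt (phi (vstar p) / n%:R + vstar p / n%:R * ln (2 / delta)) + rest
    /\ dist <= 2 * Num.sqrt (vstar p * ln (n%:R + 1) / n%:R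
                             + vstar p / n%:R * ln (2 / delta)) + rest)).
move=> t /= nbad.
have nlarge : ~ large_deviation p delta (fun j => X j t) by move=> H; apply: nbad; left.
have ncrowd : ~ overcrowding p (fun j => X j t) by move=> H; apply: nbad; right.
have bound B := linf_dist_mle_le (B := B) hp hn hdelta nlarge ncrowd.
(* Only the variance in front of ln (2 / delta) is replaced by vstar: the one in
   front of ln (k+2) is kept for Vstar. *)
have vL k : var_at (desc p) k * rank_exponent delta k <=
    2 * (var_at (desc p) k * ln k.+2%:R) + 2 * (vstar p * ln (2 / delta)).
  have vk0 : 0 <= var_at (desc p) k := var_at_ge0 hp _.
  have vkv : var_at (desc p) k <= vstar p := var_at_vstar p (ranking p k).
  have := ler_wpM2l vk0 (rank_exponent_le_ln hdelta k).
  have := ler_wpM2r lnd vkv; have := mulr_ge0 v0 lnd; lra.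
split; first (apply/andP; split).
- apply: bound => k kn; apply: le_trans (vL k) _.
  have -> : 2 * n%:R * (Vstar p / n%:R + vstar p / n%:R * ln (2 / delta)) =
    2 * Vstar p + 2 * (vstar p * ln (2 / delta)) by field; rewrite gt_eqF.
  by rewrite lerD2r ler_pM2l // (Vstar_ub hp).
- rewrite lerD2r ler_pM2l //; apply: ler_wsqrtr.
  by rewrite lerD2r ler_pM2r ?invr_gt0// (Vstar_le_phi hp).
- apply: bound => k kn; apply: le_trans (vL k) _.
  have -> : 2 * n%:R * (vstar p * ln (n%:R + 1) / n%:R + vstar p / n%:R * ln (2 / delta)) =
    2 * (vstar p * ln (n%:R + 1)) + 2 * (vstar p * ln (2 / delta)) by field; rewrite gt_eqF.
  rewrite lerD2r ler_pM2l // natr1; apply: ler_pM.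
  + exact: (var_at_ge0 hp (ranking p k)).
  + by rewrite ln_ge0 // ler1n.
  + exact: (var_at_vstar p (ranking p k)).
  + by rewrite ler_ln ?posrE ?ltr0n// ler_nat.
Qed.
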